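(* Let $p$ be a prime number, let $k, n$ be integers with $1 \le k \le n$, and let $\xi\in\mathbb{Q}_p$ be transcendental over $\mathbb{Q}$. Then $$\lambda_n (\xi) \ge \frac{w_k (\xi) - n + k}{(k-1)\, w_k (\xi) + n}.$$
   Context: $|\cdot|_p$ is the usual $p$-adic absolute value on $\mathbb{Q}_p$, normalized by $|p|_p=p^{-1}$. For an integer $n\ge 1$ and $\xi\in\mathbb{Q}_p$, $\lambda_n(\xi)\in[-\infty,+\infty]$ denotes the supremum of the real numbers $\lambda$ such that, for arbitrarily large real numbers $X$, the inequalities $$\max\{|x_0|,\ldots,|x_n|\}\le X,\qquad 0<\max_{1\le m\le n}|x_0\xi^m-x_m|_p\le X^{-\lambda-1}$$ have a solution in integers $x_0,\ldots,x_n$. For an integer $n\ge 1$ and $\xi\in\mathbb{Q}_p$, $w_n(\xi)\in[-\infty,+\infty]$ denotes the supremum of the real numbers $w$ such that, for arbitrarily large real numbers $X$, the inequalities $$0<|x_n\xi^n+\cdots+x_1\xi+x_0|_p\le X^{-w-1},\qquad \max_{0\le m\le n}|x_m|\le X$$ have a solution in integers $x_0,\ldots,x_n$. When $w_k(\xi)=+\infty$, the right-hand side of the inequality is understood as its limit as $w_k(\xi)\to+\infty$, namely $1/(k-1)$ if $k\ge 2$ and $+\infty$ if $k=1$. *)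

(* Defs.v *)
From HB Require Import structures.
From mathcomp Require Import all_boot all_order all_algebra.
From mathcomp Require Import generic_quotient ring_quotient.
From mathcomp Require Import ring.
From mathcomp Require Import all_classical all_reals all_analysis.

Set Implicit Arguments.
Unset Strict Implicit.
Unset Printing Implicit Defensive.

Import Order.TTheory GRing.Theory Num.Theory.
Import numFieldNormedType.Exports.

Local Open Scope ring_scope.
Local Open Scope quotient_scope.

Section PadicNormRat.
Variable p : nat.

Definition pval (q : rat) : int :=
  (logn p `|numq q|%N)%:Z - (logn p `|denq q|%N)%:Z.

Definition pnorm (q : rat) : rat :=
  if q == 0 then 0 else (p%:R : rat) ^ (- pval q).

Implicit Types q r e : rat.

Hypothesis p_pr : prime p.

Let p_gt0 : 0 < (p%:R : rat).
Proof. by rewrite ltr0n prime_gt0. Qed.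

Let p_ge1 : 1 <= (p%:R : rat).
Proof. by rewrite ler1n prime_gt0. Qed.

Lemma pvalE (q : rat) (a b : int) : a != 0 -> b != 0 -> q * b%:~R = a%:~R ->
  pval q = (logn p `|a|%N)%:Z - (logn p `|b|%N)%:Z.
Proof.
move=> a0 b0 qba.
have q0 : q != 0.
  by apply: contraNneq a0 => q0; rewrite -(@intr_eq0 rat) -qba q0 mul0r.
have /(congr1 absz) : numq q * b = a * denq q.
  apply: (@intr_inj rat); rewrite !intrM -qba -{2}[q]divq_num_den.
  by rewrite mulrAC mulfVK // intr_eq0 denq_neq0.
rewrite !abszM => /(congr1 (logn p)).
rewrite !lognM ?absz_gt0 ?numq_eq0 ?denq_neq0 // /pval => e.
by apply/eqP; rewrite subr_eq addrAC eq_sym subr_eq -!PoszD e.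
Qed.

Lemma pnorm0 : pnorm 0 = 0. Proof. by rewrite /pnorm eqxx. Qed.

Lemma pnorm_ge0 q : 0 <= pnorm q.
Proof. by rewrite /pnorm; case: eqP => // _; rewrite exprz_ge0 ?ltW. Qed.

Lemma pnorm_eq0 q : (pnorm q == 0) = (q == 0).
Proof.
rewrite /pnorm; case: ifP => [_|q0]; first by rewrite eqxx.
by rewrite expfz_eq0 (gt_eqF p_gt0) andbF.
Qed.

Lemma pnormM q r : pnorm (q * r) = pnorm q * pnorm r.
Proof.
rewrite {1 2 3}/pnorm mulf_eq0.
have [_|q0] := eqVneq q 0; first by rewrite mul0r.
have [_|r0] := eqVneq r 0; first by rewrite mulr0.
rewrite -expfzDr ?gt_eqF //= -opprD; congr (_ ^ (- _)).
rewrite (@pvalE (q * r) (numq q * numq r) (denq q * denq r)).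
- rewrite !abszM !lognM ?absz_gt0 ?numq_eq0 ?denq_neq0 // /pval !PoszD.
  by rewrite opprD addrACA.
- by rewrite mulf_eq0 !numq_eq0 negb_or q0.
- by rewrite mulf_eq0 negb_or !denq_neq0.
- by rewrite !intrM !numqE mulrACA.
Qed.

Lemma pnorm1 : pnorm 1 = 1.
Proof. by rewrite /pnorm oner_eq0 /pval subrr. Qed.

Lemma pnormN q : pnorm (- q) = pnorm q.
Proof. by rewrite /pnorm oppr_eq0 /pval numqN denqN abszN. Qed.

Lemma pnormB q r : pnorm (q - r) = pnorm (r - q).
Proof. by rewrite -opprB pnormN. Qed.

Lemma pnormD q r : pnorm (q + r) <= Num.max (pnorm q) (pnorm r).
Proof.
have [->|q0] := eqVneq q 0; first by rewrite add0r le_max lexx orbT.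
have [->|r0] := eqVneq r 0; first by rewrite addr0 le_max lexx.
have [->|qr0] := eqVneq (q + r) 0; first by rewrite pnorm0 le_max pnorm_ge0.
pose d := denq q * denq r; pose a := numq q * denq r; pose b := numq r * denq q.
have d0 : d != 0 by rewrite mulf_eq0 negb_or !denq_neq0.
have a0 : a != 0 by rewrite mulf_eq0 negb_or numq_eq0 denq_neq0 q0.
have b0 : b != 0 by rewrite mulf_eq0 negb_or numq_eq0 denq_neq0 r0.
have qd : q * d%:~R = a%:~R by rewrite !intrM numqE mulrA.
have rd : r * d%:~R = b%:~R by rewrite !intrM numqE mulrCA mulrA mulrC mulrA mulrAC [_ * r]mulrC.
have qrd : (q + r) * d%:~R = (a + b)%:~R by rewrite mulrDl qd rd intrD.
have ab0 : a + b != 0.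
  rewrite -(@intr_eq0 rat) -qrd mulf_eq0 negb_or qr0 intr_eq0 //.
rewrite /pnorm (negPf q0) (negPf r0) (negPf qr0).
rewrite (pvalE a0 d0 qd) (pvalE b0 d0 rd) (pvalE ab0 d0 qrd) !opprB.
have key : (minn (logn p `|a|%N) (logn p `|b|%N) <= logn p `|(a + b)%R|%N)%N.
  rewrite -pfactor_dvdn ?absz_gt0 //.
  set m := minn _ _; suff : ((p ^ m)%N%:Z %| a + b)%Z by [].
  rewrite rpredD // dvdzE /= pfactor_dvdn ?absz_gt0 //.
    exact: geq_minl.
  exact: geq_minr.
by rewrite le_max; move: key; rewrite geq_min => /orP[] k; apply/orP; [left|right];
  rewrite ler_weXz2l // lerD2l lerN2 lez_nat.
Qed.

Lemma pnormD_lt q r e : pnorm q < e -> pnorm r < e -> pnorm (q + r) < e.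
Proof.
by move=> qe re; apply: le_lt_trans (pnormD q r) _; rewrite gt_max qe.
Qed.

Lemma pnorm_isosceles q r : pnorm (q - r) < pnorm r -> pnorm q = pnorm r.
Proof.
move=> h; apply/le_anti/andP; split.
  rewrite -[q](subrK r); apply: le_trans (pnormD _ _) _.
  by rewrite ge_max lexx ltW.
rewrite leNgt; apply/negP => qr.
move: h; rewrite pnormB => h; have := pnormD_lt h qr.
by rewrite subrK ltxx.
Qed.

Lemma pnorm_dist q r : `|pnorm q - pnorm r| <= pnorm (q - r).
Proof.
have h a b : pnorm a - pnorm b <= pnorm (a - b).
  rewrite lerBlDr -{1}[a](subrK b); apply: le_trans (pnormD _ _) _.
  by rewrite ge_max lerDl lerDr !pnorm_ge0.
by rewrite ler_norml h andbT lerNl opprB pnormB h.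
Qed.

Lemma pnormV q : pnorm q^-1 = (pnorm q)^-1.
Proof.
have [->|q0] := eqVneq q 0; first by rewrite pnorm0 invr0 pnorm0.
apply: (@mulIf _ (pnorm q)); first by rewrite pnorm_eq0.
by rewrite -pnormM !mulVf ?pnorm_eq0 // pnorm1.
Qed.

End PadicNormRat.

Section PadicCompletion.
Variable p : nat.

(* The primality proof is a phantom argument, so that the ring structures below,
   which need it, can be inferred. *)
Definition padic_cauchy of prime p : {pred nat -> rat} := fun u =>
  `[< forall e : rat, 0 < e -> exists N, forall i j, (N <= i)%N -> (N <= j)%N ->
        pnorm p (u i - u j) < e >].

Variable p_pr : prime p.

Lemma padic_cauchy_bounded u : u \in padic_cauchy p_pr ->
  exists2 B : rat, 0 < B & exists N, forall i, (N <= i)%N -> pnorm p (u i) < B.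
Proof.
move=> /asboolP /(_ 1 ltr01)[N hN]; exists (1 + pnorm p (u N)).
  by rewrite ltr_wpDr // pnorm_ge0.
exists N => i Ni; rewrite -[u i](subrK (u N)).
apply: le_lt_trans (pnormD p_pr _ _) _; rewrite gt_max.
by rewrite ltr_wpDr ?pnorm_ge0 ?hN //= ltrDr ltr01.
Qed.

Lemma padic_cauchy_subring : subring_closed (padic_cauchy p_pr).
Proof.
split.
- by apply/asboolP => e e0; exists 0%N => i j _ _; rewrite subrr pnorm0.
- move=> u v /asboolP uC /asboolP vC; apply/asboolP => e e0.
  have [N hN] := uC e e0; have [M hM] := vC e e0.
  exists (maxn N M) => i j; rewrite !geq_max => /andP[Ni Mi] /andP[Nj Mj].
  rewrite [X in pnorm p X](_ : _ = (u i - u j) + (v j - v i)).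
    by apply: pnormD_lt => //; [exact: hN|exact: hM].
  by transitivity ((u i - v i) - (u j - v j)) => //; ring.
- move=> u v uC' vC'; have [B B0 [Nb hB]] := padic_cauchy_bounded uC'.
  have [C C0 [Nc hC]] := padic_cauchy_bounded vC'.
  move: uC' vC' => /asboolP uC /asboolP vC; apply/asboolP => e e0.
  have [N hN] := uC (e / C) (divr_gt0 e0 C0).
  have [M hM] := vC (e / B) (divr_gt0 e0 B0).
  exists (maxn (maxn N M) (maxn Nb Nc)) => i j.
  rewrite !geq_max => /andP[/andP[Ni Mi] /andP[bi ci]].
  move=> /andP[/andP[Nj Mj] /andP[bj cj]].
  rewrite [X in pnorm p X](_ : _ = u i * (v i - v j) + (u i - u j) * v j).
    apply: pnormD_lt => //; rewrite pnormM //.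
      rewrite -[e](@divfK _ B) ?gt_eqF // mulrC.
      by apply: ltr_pM; rewrite ?pnorm_ge0 ?hM ?hB.
    rewrite -[e](@divfK _ C) ?gt_eqF //.
    by apply: ltr_pM; rewrite ?pnorm_ge0 ?hN ?hC.
  by transitivity (u i * v i - u j * v j) => //; ring.
Qed.

HB.instance Definition _ := GRing.isSubringClosed.Build (nat -> rat) (padic_cauchy p_pr)
  padic_cauchy_subring.

Record cauchy_seq := CauchySeq {
  cauchy_val :> nat -> rat;
  cauchy_valP : cauchy_val \in padic_cauchy p_pr }.

HB.instance Definition _ := [isSub for cauchy_val].
HB.instance Definition _ := [Choice of cauchy_seq by <:].
HB.instance Definition _ := [SubChoice_isSubComNzRing of cauchy_seq by <:].

Definition padic_null : {pred cauchy_seq} := fun u =>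
  `[< forall e : rat, 0 < e -> exists N, forall i, (N <= i)%N ->
        pnorm p (u i) < e >].

Lemma padic_null_ideal : idealr_closed padic_null.
Proof.
split.
- by apply/asboolP => e e0; exists 0%N => i _; rewrite pnorm0.
- by apply/negP => /asboolP /(_ 1 ltr01)[N /(_ N (leqnn N))];
    rewrite pnorm1 // ltxx.
- move=> a u v /asboolP u0 /asboolP v0; apply/asboolP => e e0.
  have [B B0 [Nb hB]] := padic_cauchy_bounded (cauchy_valP a).
  have [N hN] := u0 (e / B) (divr_gt0 e0 B0).
  have [M hM] := v0 e e0.
  exists (maxn Nb (maxn N M)) => i; rewrite !geq_max => /and3P[bi Ni Mi].
  rewrite [X in pnorm p X](_ : _ = a i * u i + v i) //.
  apply: pnormD_lt (hM _ Mi) => //; rewrite pnormM //.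
  rewrite -[e](@divfK _ B) ?gt_eqF // mulrC.
  by apply: ltr_pM; rewrite ?pnorm_ge0 ?hN ?hB.
Qed.

HB.instance Definition _ := isIdealr.Build cauchy_seq padic_null padic_null_ideal.

Lemma pnorm_eventually_const (u : cauchy_seq) : u \notin padic_null ->
  exists2 c : rat, 0 < c & exists N, forall i, (N <= i)%N -> pnorm p (u i) = c.
Proof.
move=> /asboolPn un.
have {un}[e [e0 he]] : exists e : rat, 0 < e /\
    forall N, exists2 i, (N <= i)%N & e <= pnorm p (u i).
  apply/not_existsP => h; apply: un => e e0.
  have /not_andP[//|/existsNP[N hN]] := h e.
  exists N => i Ni; rewrite ltNge; apply/negP => ei; apply: hN.
  by exists i.
have /asboolP /(_ e e0)[N hN] := cauchy_valP u.
have [i Ni ei] := he N.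
exists (pnorm p (u i)); first exact: lt_le_trans ei.
by exists N => j Nj; apply: pnorm_isosceles => //; apply: lt_le_trans (hN _ _ _ _) ei.
Qed.

Definition padic : Type := {ideal_quot padic_null}.

HB.instance Definition _ := GRing.ComNzRing.on padic.
HB.instance Definition _ := EqQuotient.on padic.

Lemma padic_has_inv (x : padic) : x != 0 -> exists y : padic, y * x = 1.
Proof.
rewrite -[x]reprK; set u := repr x => u0.
have un : u \notin padic_null.
  apply: contra u0 => un.
  by rewrite -[0]pi_zeror -Quotient.idealrBE subr0.
have [c c0 [N hN]] := pnorm_eventually_const un.
have uN0 i : (N <= i)%N -> u i != 0.
  by move=> Ni; rewrite -(pnorm_eq0 p_pr) hN // gt_eqF.
pose v : nat -> rat := fun i => (u i)^-1.
have vC : v \in padic_cauchy p_pr.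
  apply/asboolP => e e0.
  have /asboolP /(_ (e * (c * c)))[|M hM] := cauchy_valP u.
    by rewrite !mulr_gt0.
  exists (maxn N M) => i j; rewrite !geq_max => /andP[Ni Mi] /andP[Nj Mj].
  rewrite [X in pnorm p X](_ : _ = (u j - u i) * ((u i)^-1 * (u j)^-1)).
    rewrite !(pnormM p_pr) !(pnormV p_pr) !hN // -invfM ltr_pdivrMr ?mulr_gt0 //.
    exact: hM.
  rewrite mulrBl /v [(u i)^-1 * _]mulrC !mulrA mulfV ?uN0 // mul1r.
  by rewrite mulrAC mulfV ?uN0 // mul1r.
exists (\pi_padic (CauchySeq vC)).
have <- : \pi_padic 1 = 1 :> padic by exact: pi_oner.
have <- : \pi_padic (CauchySeq vC * u) = \pi_padic (CauchySeq vC) * \pi_padic u.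
  exact: pi_mulr.
apply/eqP; rewrite -Quotient.idealrBE; apply/asboolP => e e0.
exists N => i Ni.
rewrite [X in pnorm p X](_ : _ = v i * u i - 1) //.
by rewrite /v mulVf ?uN0 // subrr pnorm0.
Qed.

Definition padic_inv (x : padic) : padic := xget 0 [set y | y * x = 1]%classic.

Lemma padic_mulVx (x : padic) : x != 0 -> padic_inv x * x = 1.
Proof.
by move=> /padic_has_inv[y yx]; exact: (@xgetPex _ 0 [set y | y * x = 1]%classic (ex_intro _ y yx)).
Qed.

Lemma padic_inv0 : padic_inv 0 = 0.
Proof.
apply: xgetPN => y /=; rewrite mulr0 => /esym/eqP.
by rewrite oner_eq0.
Qed.

HB.instance Definition _ :=
  GRing.ComNzRing_isField.Build padic padic_mulVx padic_inv0.

End PadicCompletion.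

Arguments padic_null {p} p_pr _.

Section PadicAbs.
Local Open Scope classical_set_scope.
Variables (p : nat) (p_pr : prime p) (R : realType).
Implicit Types (x y : padic p_pr) (u v : cauchy_seq p_pr).

Definition padic_abs x : R := limn (fun i => ratr (pnorm p (repr x i)) : R).

Lemma cauchy_pnorm_cvg0 u : u \in padic_null p_pr ->
  (ratr (pnorm p (u i)) : R) @[i --> \oo] --> (0 : R).
Proof.
move=> u0; apply/cvgrPdist_lt => e e0.
have [q /[!in_itv]/= /andP[q0 qe]] := rat_in_itvoo e0.
have /asboolP /(_ q)[|N hN] := u0; first by rewrite -(ltr0q R).
exists N => // i /= Ni; rewrite sub0r normrN ger0_norm ?ler0q ?pnorm_ge0 //.
by apply: lt_trans qe; rewrite ltr_rat hN.
Qed.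

Lemma cauchy_pnorm_cvg u : cvgn (fun i => ratr (pnorm p (u i)) : R).
Proof.
have [u0|un] := boolP (u \in padic_null p_pr); last first.
  have [c _ [N hN]] := pnorm_eventually_const un.
  apply/cvg_ex; exists (ratr c); apply: cvg_near_cst.
  by exists N => // i /= Ni; rewrite hN.
by apply/cvg_ex; exists 0; exact: cauchy_pnorm_cvg0.
Qed.

Lemma padic_abs_pi u :
  (ratr (pnorm p (u i)) : R) @[i --> \oo] --> padic_abs (\pi_(padic p_pr) u).
Proof.
set v := repr (\pi_(padic p_pr) u).
have uv0 : u - v \in padic_null p_pr.
  by rewrite Quotient.idealrBE reprK.
have vc := @cauchy_pnorm_cvg v.
rewrite /padic_abs -/v -[X in _ --> X]add0r.
rewrite [X in X @ _](_ : _ = (fun i => (ratr (pnorm p (u i)) - ratr (pnorm p (v i)) : R)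
   + ratr (pnorm p (v i)))); last by apply/funext => i; rewrite subrK.
apply: cvgD => //; apply: norm_cvg0.
apply: (@squeeze_cvgr _ _ _ _ (fun=> 0) (fun i => ratr (pnorm p ((u - v) i)))).
- apply: nearW => i; rewrite normr_ge0 /= -rmorphB -ratr_norm ler_rat.
  exact: pnorm_dist.
- exact: cvg_cst.
- exact: cauchy_pnorm_cvg0.
Qed.

Lemma padic_abs_lim u l :
  (ratr (pnorm p (u i)) : R) @[i --> \oo] --> l -> padic_abs (\pi_(padic p_pr) u) = l.
Proof. by move=> ul; apply: cvg_unique ul; [|exact: padic_abs_pi]. Qed.

Lemma padic_abs_ge0 x : 0 <= padic_abs x.
Proof.
apply: limr_ge; first exact: cauchy_pnorm_cvg.
by apply: nearW => i; rewrite ler0q pnorm_ge0.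
Qed.

Lemma padic_absM x y : padic_abs (x * y) = padic_abs x * padic_abs y.
Proof.
rewrite -[x]reprK -[y]reprK -(pi_mulr (repr x) (repr y)).
apply: padic_abs_lim.
rewrite [X in X @ _](_ : _ = fun i => ratr (pnorm p (repr x i)) *
  ratr (pnorm p (repr y i)) : R).
  by apply: cvgM; exact: padic_abs_pi.
by apply/funext => i; rewrite -rmorphM -pnormM.
Qed.

Lemma padic_abs_eq0 x : (padic_abs x == 0) = (x == 0).
Proof.
rewrite -[x]reprK; set u := repr x.
have -> : (\pi_(padic p_pr) u == 0) = (u \in padic_null p_pr).
  by rewrite -[0]pi_zeror -Quotient.idealrBE subr0.
apply/eqP/idP => [a0|/cauchy_pnorm_cvg0]; last exact: padic_abs_lim.
apply/negPn/negP => /pnorm_eventually_const[c c0 [N hN]].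
have cu : (ratr (pnorm p (u i)) : R) @[i --> \oo] --> (ratr c : R).
  by apply: cvg_near_cst; exists N => // i /= Ni; rewrite hN.
have := padic_abs_lim cu; rewrite a0 => /esym/eqP.
by rewrite fmorph_eq0 gt_eqF.
Qed.

Lemma padic_absD x y :
  padic_abs (x + y) <= Num.max (padic_abs x) (padic_abs y).
Proof.
rewrite -[x]reprK -[y]reprK -(pi_addr (repr x) (repr y)).
set u := repr x; set v := repr y.
have uvl := @padic_abs_pi (u + v); have ul := @padic_abs_pi u; have vl := @padic_abs_pi v.
rewrite -(cvg_lim _ uvl) // leNgt; apply/negP; rewrite gt_max => /andP[xlt ylt].
set l := limn _ in xlt ylt.
have {}uvl : (ratr (pnorm p ((u + v) i)) : R) @[i --> \oo] --> l by apply/cvg_ex; exists (padic_abs (\pi_(padic p_pr) (u + v))).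
pose m := (l + Num.max (padic_abs (\pi_(padic p_pr) u)) (padic_abs (\pi_(padic p_pr) v))) / 2.
have : \forall i \near \oo, False.
  have ml : m < l by rewrite /m ltr_pdivrMr // mulr_natr mulr2n ltrD2l gt_max xlt.
  have um : padic_abs (\pi_(padic p_pr) u) < m.
    rewrite /m ltr_pdivlMr // mulr_natr mulr2n ltr_leD // le_max lexx //.
  have vm : padic_abs (\pi_(padic p_pr) v) < m.
    rewrite /m ltr_pdivlMr // mulr_natr mulr2n ltr_leD // le_max lexx orbT //.
  near=> i.
  have : (ratr (pnorm p (u i)) : R) < m by near: i; exact: cvgr_lt ul _ um.
  have : (ratr (pnorm p (v i)) : R) < m by near: i; exact: cvgr_lt vl _ vm.
  have : m < (ratr (pnorm p ((u + v) i)) : R) by near: i; exact: cvgr_gt uvl _ ml.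
  move=> h1 h2 h3.
  have := pnormD p_pr (u i) (v i); rewrite -(ler_rat R) leNgt => /negP; apply.
  by apply: lt_trans h1; rewrite maxEle; case: ifP.
by case=> N _ hN; exact: (hN N (leqnn N)).
Unshelve. all: by end_near.
Qed.

Lemma padic_cst_cauchy (q : rat) : (fun=> q) \in padic_cauchy p_pr.
Proof. by apply/asboolP => e e0; exists 0%N => i j _ _; rewrite subrr pnorm0. Qed.

Lemma padic_abs_rat (q : rat) : padic_abs (ratr q) = ratr (pnorm p q).
Proof.
pose c (r : rat) := \pi_(padic p_pr) (CauchySeq (padic_cst_cauchy r)).
have cabs r : padic_abs (c r) = ratr (pnorm p r).
  by apply: padic_abs_lim => /=; exact: cvg_cst.
have cD r s : c (r + s) = c r + c s.
  by rewrite /c -pi_addr; congr (\pi_ _ _); exact: val_inj.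
have cM r s : c (r * s) = c r * c s.
  by rewrite /c -pi_mulr; congr (\pi_ _ _); exact: val_inj.
have c1 : c 1 = 1.
  by rewrite /c -pi_oner; congr (\pi_ _ _); exact: val_inj.
have c0 : c 0 = 0.
  by rewrite /c -pi_zeror; congr (\pi_ _ _); exact: val_inj.
have cn (m : nat) : c m%:R = m%:R.
  by elim: m => // m IH; rewrite !mulrS cD c1 IH.
have cN r : c (- r) = - c r.
  by apply/eqP; rewrite -addr_eq0 -cD addNr c0.
have cz (m : int) : c m%:~R = m%:~R.
  case: m => m; first exact: cn.
  by rewrite NegzE !mulrNz cN cn.
have dn0 : c (denq q)%:~R != 0.
  by rewrite -padic_abs_eq0 cabs fmorph_eq0 pnorm_eq0 // intr_eq0 denq_neq0.
rewrite -cabs; congr padic_abs; rewrite /ratr -!cz.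
apply: (mulIf dn0); rewrite mulfVK // -cM.
by rewrite -{2}[q]divq_num_den mulfVK // intr_eq0 denq_neq0.
Qed.

End PadicAbs.

Section Exponents.
Variables (R : realType) (p : nat) (p_pr : prime p).

Local Open Scope classical_set_scope.

Definition lambda_exp (n : nat) (xi : padic p_pr) : \bar R :=
  ereal_sup [set l%:E | l in [set l : R |
    forall A : R, exists2 X : R, A < X & exists x : 'I_n.+1 -> int,
      (\big[Num.max/0]_(m < n.+1) `|x m|)%:~R <= X /\
      0 < \big[Num.max/0]_(m < n.+1 | (0 < m)%N)
            padic_abs R ((x ord0)%:~R * xi ^+ m - (x m)%:~R) <= X `^ (- l - 1)]].

Definition w_exp (n : nat) (xi : padic p_pr) : \bar R :=
  ereal_sup [set w%:E | w in [set w : R |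
    forall A : R, exists2 X : R, A < X & exists x : 'I_n.+1 -> int,
      0 < padic_abs R (\sum_(m < n.+1) (x m)%:~R * xi ^+ m) <= X `^ (- w - 1) /\
      (\big[Num.max/0]_(m < n.+1) `|x m|)%:~R <= X]].

End Exponents.

(* At w = +oo and w = -oo the value is the limit of the rational function. *)
Definition transference_bound (R : realType) (k n : nat) (w : \bar R) : \bar R :=
  match w with
  | EFin r => ((r - n%:R + k%:R) / ((k%:R - 1) * r + n%:R))%:E
  | +oo%E => if (1 < k)%N then ((k%:R - 1)^-1)%:E else +oo%E
  | -oo%E => if (1 < k)%N then ((k%:R - 1)^-1)%:E else -oo%E
  end.

(* Main.v *)
Require Import Defs.
From HB Require Import structures.
From mathcomp Require Import all_boot all_order all_algebra.
From mathcomp Require Import generic_quotient ring_quotient.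
From mathcomp Require Import all_classical all_reals all_analysis.
From mathcomp Require Import ring lra zify.

Set Implicit Arguments.
Unset Strict Implicit.
Unset Printing Implicit Defensive.

Import Order.TTheory GRing.Theory Num.Theory.
Import numFieldNormedType.Exports.

Local Open Scope ring_scope.

(** Let P = a_0 + a_1 X + ... + a_k X^k be an integer polynomial of height H
    with |P(xi)|_p about p^-N.  An integer vector x = (x_0, ..., x_n) is a good
    simultaneous approximation of (1, xi, ..., xi^n) when all the differences
    y_m = x_0 xi^m - x_m are divisible by p^N.  Asking for this directly costs
    n congruences modulo p^N.  The polynomial makes it cheaper: require first
    that x satisfy the n - k + 1 integer equations
      L_j(x) = a_0 x_j + ... + a_k x_(j+k) = 0    (0 <= j <= n - k),
    that is, that x be annihilated by P, X P, ..., X^(n-k) P.  Since P(xi) is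
    divisible by p^N, the y_m then satisfy the same recurrence modulo p^N, and
    so all of them vanish as soon as k - 1 well chosen ones do
    (recurrence_dvd).  The pigeonhole principle on a box of side Y produces
    such an x when Y^(n+1) exceeds, up to a constant factor,
    (H Y)^(n-k+1) p^(N(k-1)), that is, when Y^k is about
    H^(n-k+1) p^(N(k-1)) (integer_transference).

    If moreover p^N = H^(w+1), then Y = H^(((k-1)w+n)/k), and p^-N = Y^(-l-1)
    holds for l = (w-n+k)/((k-1)w+n), the asserted bound; a smaller l leaves a
    positive power of p^N to absorb the constants (transference).

    The pigeonhole count needs P to have a coefficient prime to p.  Dividing P
    by the power of p in its content only improves the approximation when
    w >= 0, because |P(xi)|_p grows by the factor by which the height shrinks
    (primitive_approximation).  The argument also needs |xi|_p <= 1, so that xi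
    is congruent to an integer r modulo p^N and everything becomes a statement
    on integers (padic_int_approx); since multiplying xi by a nonzero integer d
    can only increase w_k and decrease lambda_n (w_exp_scale,
    lambda_exp_scale), xi may be replaced by p^M xi.

    Finally w_k(xi) >= 0, from constant polynomials p^M, and lambda_n(xi) >= 0,
    from vectors (p^M, 0, ..., 0); so the bound only has to be proved where it
    is positive, which forces w_k(xi) > 0. *)

(** * Integer vectors annihilated by shifts of a polynomial *)

(** Modulo p only the coefficients a_i with i <= i0 survive, so the recurrence
    determines y_m, for i0 <= m <= n - k + i0, from the terms of smaller index:
    divisibility by a higher power of p propagates upwards in m, one power at
    a time.  The terms to be prescribed are the first i0 and the last k - i0. *)
Lemma recurrence_dvd (p k n N i0 : nat) (a y : nat -> int) :
  prime p -> (i0 <= k <= n)%N -> ~~ (p %| a i0)%Z ->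
  (forall i, (i0 < i <= k)%N -> (p %| a i)%Z) ->
  (forall j, (j <= n - k)%N -> ((p ^ N)%N %| \sum_(i < k.+1) a i * y (i + j)%N)%Z) ->
  (forall m, (m < i0)%N || (n - k + i0 < m <= n)%N -> ((p ^ N)%N %| y m)%Z) ->
  forall m, (m <= n)%N -> ((p ^ N)%N %| y m)%Z.
Proof.
move=> p_pr /andP[i0k kn] ai0 ahigh rec yknown.
suff H v : (v <= N)%N -> forall m, (m <= n)%N -> ((p ^ v)%N %| y m)%Z.
  by move=> m; apply: H.
elim: v => [|v IHv] vN m; first by rewrite expn0 dvd1z.
have dvdN (z : int) : ((p ^ N)%N %| z)%Z -> ((p ^ v.+1)%N %| z)%Z.
  by apply: dvdz_trans; rewrite dvdzE /= dvdn_exp2l.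
elim/ltn_ind: m => m IHm mn.
have [mi0|i0m] := ltnP m i0; first by apply/dvdN/yknown; rewrite mi0.
have [mhigh|mlow] := ltnP (n - k + i0) m.
  by apply/dvdN/yknown; rewrite mhigh mn orbT.
(* Equation j = m - i0 is the one where a_i0 multiplies y_m. *)
have /rec/dvdN : (m - i0 <= n - k)%N by rewrite leq_subLR addnC.
rewrite (bigD1 (inord i0 : 'I_k.+1)) //= inordK ?ltnS // subnKC //.
rewrite rpredDr; last first.
  apply: rpred_sum => i ii0.
  have {}ii0 : i != i0 :> nat.
    by apply: contraNneq ii0 => ii0; apply/eqP/val_inj; rewrite /= inordK.
  have ik := ltn_ord i.
  have [il|ig|ie] := ltngtP i i0; last by rewrite ie eqxx in ii0.
    by apply/dvdz_mull/IHm; lia.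
  rewrite expnS PoszM; apply: dvdz_mul; first by apply: ahigh; rewrite ig.
  by apply: IHv; lia.
rewrite Gauss_dvdzr // coprimezE /= coprimeXl //.
by rewrite prime_coprime.
Qed.

Lemma pigeonhole (S T : finType) (f : S -> T) :
  (#|T| < #|S|)%N -> exists u v, u != v /\ f u = f v.
Proof.
move=> TS; have : ~~ injectiveb f.
  by apply: contraL TS => /injectiveP /leq_card; rewrite -leqNgt.
by case/injectivePn => u [v uv fuv]; exists u, v.
Qed.

Lemma sum_norm_le (k H Y : nat) (a x : nat -> int) :
  (forall i, (i <= k)%N -> `|a i| <= H) -> (forall i, `|x i| <= Y) ->
  forall j, `|\sum_(i < k.+1) a i * x (i + j)%N| <= (k.+1 * H * Y)%N.
Proof.
move=> aH xY j; apply: le_trans (ler_norm_sum _ _ _) _.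
have -> : ((k.+1 * H * Y)%N : int) = \sum_(i < k.+1) (H%:Z * Y%:Z).
  by rewrite sumr_const card_ord -mulr_natl natz -mulnA !PoszM.
apply: ler_sum => i _; rewrite normrM; apply: ler_pM => //.
by apply: aH; rewrite -ltnS.
Qed.

Lemma ord_dist_le (Y : nat) (i j : 'I_Y.+1) : `|(i : nat)%:Z - (j : nat)%:Z| <= Y.
Proof. have := ltn_ord i; have := ltn_ord j; lia. Qed.

Lemma shifted_range_le (K H Y : nat) : (0 < K)%N -> (0 < H)%N ->
  ((2 * (K * H * Y)).+1 <= 2 * K * H * Y.+1)%N.
Proof. by move=> K0 H0; nia. Qed.

Lemma inord_shift_inj (B : nat) (a b : int) : `|a| <= B -> `|b| <= B ->
  inord `|(a + B)%R|%N = inord `|(b + B)%R|%N :> 'I_(2 * B).+1 -> a = b.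
Proof. by move=> aB bB /(congr1 (@nat_of_ord _)); rewrite !inordK; lia. Qed.

(** The vector x is the difference of two points of the box {0, ..., Y}^(n+1)
    with the same n - k + 1 values L_j, and the same k - 1 residues modulo p^N
    of the differences y_m prescribed in recurrence_dvd.  As y_0 = 0 always
    holds, k - 1 conditions suffice provided i0 > 0. *)
Lemma integer_transference (p k n N H Y : nat) (r : int) (a : nat -> int) :
  prime p -> (0 < k <= n)%N -> (0 < N)%N -> (0 < H)%N ->
  (exists2 i, (i <= k)%N & ~~ (p %| a i)%Z) ->
  (forall i, (i <= k)%N -> `|a i| <= H) ->
  ((p ^ N)%N %| \sum_(i < k.+1) a i * r ^+ i)%Z ->
  ((2 * k.+1 * H) ^ (n - k).+1 * (p ^ N) ^ k.-1 < Y.+1 ^ k)%N ->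
  exists x : nat -> int,
    [/\ exists2 m, (m <= n)%N & x m != 0,
        forall m, `|x m| <= Y &
        forall m, (m <= n)%N -> ((p ^ N)%N %| x 0%N * r ^+ m - x m)%Z].
Proof.
move=> p_pr /andP[k0 kn] N0 H0 [i1 i1k ai1] aH Pr YQ.
have exi : exists i, (i <= k)%N && ~~ (p %| a i)%Z by exists i1; rewrite i1k.
have ubi i : (i <= k)%N && ~~ (p %| a i)%Z -> (i <= k)%N by case/andP.
(* i0 is the last index of a coefficient prime to p. *)
have [i0 /andP[i0k ai0] i0max] := ex_maxnP exi ubi.
have ahigh i : (i0 < i <= k)%N -> (p %| a i)%Z.
  move=> /andP[i0i ik]; apply: contraTT i0i => ai; rewrite -leqNgt.
  by apply: i0max; rewrite ik.
have pP : (p %| \sum_(i < k.+1) a i * r ^+ i)%Z.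
  by apply: dvdz_trans Pr; rewrite dvdzE /= -{1}(expn1 p) dvdn_exp2l.
(* Otherwise the polynomial would be a nonzero constant modulo p, while p
   divides its value at r. *)
have i0_gt0 : (0 < i0)%N.
  rewrite lt0n; apply: contraNneq ai0 => i00; rewrite i00 in ahigh *.
  move: pP; rewrite big_ord_recl /= expr0 mulr1 rpredDr //.
  by apply: rpred_sum => i _; apply/dvdz_mulr/ahigh; rewrite /bump /= add1n ltn_ord.
pose P := (p ^ N)%N; have P0 : (0 < P)%N by rewrite expn_gt0 prime_gt0.
pose B := (k.+1 * H * Y)%N.
(* idx enumerates the indices 1, ..., i0 - 1 and n - k + i0 + 1, ..., n. *)
pose idx t := if (t.+1 < i0)%N then t.+1 else (t.+1 + (n - k).+1)%N.
pose vec (u : {ffun 'I_n.+1 -> 'I_Y.+1}) m : int := (u (inord m) : nat)%:Z.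
pose L (x : nat -> int) j := \sum_(i < k.+1) a i * x (i + j)%N.
pose y (x : nat -> int) m := x 0%N * r ^+ m - x m.
pose f u : {ffun 'I_(n - k).+1 -> 'I_(2 * B).+1} * {ffun 'I_k.-1 -> 'I_(P.-1).+1} :=
  ([ffun j : 'I__ => inord `|(L (vec u) j + B%:Z)%R|%N],
   [ffun t : 'I__ => inord `|(y (vec u) (idx t) %% P)%Z|%N]).
have vecY u i : `|vec u i| <= Y by rewrite /vec ger0_norm // lez_nat -ltnS.
have [|u [v [uv fuv]]] := @pigeonhole _ _ f.
  rewrite card_prod !card_ffun !card_ord prednK //.
  have -> : (n.+1 = (n - k).+1 + k)%N by rewrite addSn subnK.
  rewrite expnD -/P.
  apply: (@leq_ltn_trans ((2 * k.+1 * H * Y.+1) ^ (n - k).+1 * P ^ k.-1)%N).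
    rewrite leq_mul2r leq_exp2r //; apply/orP; right.
    exact: shifted_range_le.
  by rewrite (expnMn _ Y.+1) -mulnA mulnCA ltn_pmul2l ?expn_gt0.
exists (fun m => vec u m - vec v m); split.
- have [m um] : exists m, u m != v m.
    apply/existsP; apply: contraNT uv; rewrite negb_exists => /forallP h.
    by apply/eqP/ffunP => i; apply/eqP; rewrite -[_ == _]negbK.
  exists m; first by rewrite -ltnS.
  by rewrite subr_eq0 /vec inord_val; apply: contra um => /eqP[] /val_inj ->.
- by move=> m; rewrite /vec; apply: ord_dist_le.
have Leq j : (j <= n - k)%N -> L (vec u) j = L (vec v) j.
  move=> jnk; have /ffunP/(_ (inord j)) := congr1 fst fuv; rewrite !ffunE inordK //.
  have bd w : `|L (vec w) j| <= B by exact: sum_norm_le.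
  exact: inord_shift_inj.
have yeq (t : nat) : (t < k.-1)%N -> (P %| y (vec u) (idx t) - y (vec v) (idx t))%Z.
  move=> tk; rewrite -eqz_mod_dvd.
  have /ffunP/(_ (Ordinal tk)) := congr1 snd fuv; rewrite !ffunE /=.
  have lt0P : 0 < P%:Z by [].
  have Pneq0 : P%:Z != 0 by rewrite gt_eqF.
  move=> /(congr1 (@nat_of_ord _)); rewrite !inordK ?prednK //.
  - by move=> /(congr1 Posz); rewrite !gez0_abs ?modz_ge0 // => /eqP.
  - by rewrite -ltz_nat gez0_abs ?modz_ge0 ?ltz_pmod.
  - by rewrite -ltz_nat gez0_abs ?modz_ge0 ?ltz_pmod.
have yE m : (vec u 0%N - vec v 0%N) * r ^+ m - (vec u m - vec v m) = y (vec u) m - y (vec v) m.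
  by rewrite /y; ring.
move=> m mn; rewrite yE; move: m mn.
apply: (recurrence_dvd p_pr _ ai0 ahigh); first by rewrite i0k.
- move=> j jnk.
  have -> : \sum_(i < k.+1) a i * (y (vec u) (i + j)%N - y (vec v) (i + j)%N) =
    (vec u 0%N - vec v 0%N) * r ^+ j * (\sum_(i < k.+1) a i * r ^+ i) - (L (vec u) j - L (vec v) j).
    rewrite mulr_sumr /L -!sumrB; apply: eq_bigr => i _.
    by rewrite /y exprD; ring.
  by rewrite Leq // subrr subr0 dvdz_mull.
- move=> m /orP[mi0|/andP[lo hi]].
    case: m mi0 => [|m] mi0; first by rewrite /y expr0 !mulr1 !subrr dvdz0.
    have := yeq m; rewrite /idx mi0; apply; clear -mi0 i0k; lia.
  have := yeq (m - (n - k).+2)%N; rewrite /idx ifF; last by clear -lo; lia.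
  have -> : ((m - (n - k).+2).+1 + (n - k).+1 = m)%N by clear -lo i0_gt0; lia.
  by apply; clear -lo hi i0k i0_gt0 kn; lia.
Qed.

Lemma natural_root (k Q : nat) : (0 < k)%N ->
  exists Y, (Y ^ k <= Q < Y.+1 ^ k)%N.
Proof.
move=> k0; have ex0 : exists Y, (Y ^ k <= Q)%N by exists 0%N; rewrite exp0n.
have ub Y : (Y ^ k <= Q)%N -> (Y <= Q)%N.
  by apply: leq_trans; rewrite -{1}(expn1 Y); case: Y => // Y; rewrite leq_pexp2l.
have [Y YQ Ymax] := ex_maxnP ex0 ub; exists Y; rewrite YQ ltnNge.
by apply/negP => /Ymax; rewrite ltnn.
Qed.

(** Here p^c is the exact power of p dividing the content of a. *)
Lemma content_factor (p k : nat) (a : nat -> int) : prime p ->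
  (exists2 i, (i <= k)%N & a i != 0) ->
  exists c b, (forall i, (i <= k)%N -> a i = (p ^ c)%N%:Z * b i) /\
    exists2 i, (i <= k)%N & ~~ (p %| b i)%Z.
Proof.
move=> p_pr [i1 i1k ai1].
pose D c := [forall i : 'I_k.+1, ((p ^ c)%N %| a i)%Z].
have exD : exists c, D c.
  by exists 0%N; apply/forallP => i; rewrite expn0 dvd1z.
have ubD c : D c -> (c <= `|a i1|)%N.
  move/forallP/(_ (inord i1)); rewrite inordK // dvdzE /= => h.
  have := dvdn_leq _ h; rewrite absz_gt0 => /(_ ai1) h'.
  by apply: leq_trans h'; apply/ltnW/ltn_expl/prime_gt1.
have [c /forallP Dc cmax] := ex_maxnP exD ubD.
have pc0 : (p ^ c)%N%:Z != 0 by rewrite -lt0n expn_gt0 prime_gt0.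
exists c, (fun i => (a i %/ (p ^ c)%N)%Z).
have ab i : (i <= k)%N -> a i = (p ^ c)%N%:Z * (a i %/ (p ^ c)%N)%Z.
  by move=> ik; have := Dc (inord i); rewrite inordK // dvdz_eq mulrC => /eqP.
split=> //; apply: contrapT => no.
have : D c.+1.
  apply/forallP => i; have ik : (i <= k)%N by rewrite -ltnS.
  rewrite (ab i ik) expnSr PoszM dvdz_mul2l //.
  by apply: contrapT => /negP pi; apply: no; exists (i : nat).
by move/cmax; rewrite ltnn.
Qed.

(** * The p-adic absolute value *)

Section PadicApproximation.
Context (R : realType) (p : nat) (p_pr : prime p).
Implicit Types (x y xi : padic p_pr) (z : int).
Local Notation abs := (padic_abs R).

Lemma pnorm_int z : z != 0 -> pnorm p z%:~R = p%:R ^- logn p `|z|%N.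
Proof.
move=> z0; rewrite /pnorm intr_eq0 (negPf z0) /pval numq_int denq_int logn1 subr0.
by rewrite exprnN.
Qed.

Lemma padic_abs_int z : abs (z%:~R : padic p_pr) = ratr (pnorm p z%:~R).
Proof. by rewrite -padic_abs_rat ratr_int. Qed.

Lemma pnorm_int_le z N : (pnorm p z%:~R <= p%:R ^- N) = ((p ^ N)%N %| z)%Z.
Proof.
have p0 : 0 < p%:R :> rat by rewrite ltr0n prime_gt0.
have [->|z0] := eqVneq z 0.
  by rewrite dvdz0 pnorm0 invr_ge0 exprn_ge0 // ltW.
rewrite pnorm_int // lef_pV2 ?posrE ?exprn_gt0 //.
rewrite ler_eXn2l ?ltr1n ?prime_gt1 //.
by rewrite dvdzE /= pfactor_dvdn ?absz_gt0.
Qed.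

Lemma padic_abs_int_le z N :
  (abs (z%:~R : padic p_pr) <= p%:R ^- N) = ((p ^ N)%N %| z)%Z.
Proof.
rewrite -pnorm_int_le padic_abs_int.
by rewrite -[RHS](ler_rat R) fmorphV rmorphXn /= ratr_nat.
Qed.

Lemma padic_abs_int_le1 z : abs (z%:~R : padic p_pr) <= 1.
Proof. by have := padic_abs_int_le z 0; rewrite expn0 dvd1z expr0 invr1 => ->. Qed.

Lemma padic_abs0 : abs (0 : padic p_pr) = 0.
Proof. by apply/eqP; rewrite padic_abs_eq0. Qed.

Lemma padic_abs1 : abs (1 : padic p_pr) = 1.
Proof. by have := padic_abs_int 1; rewrite mulr1z pnorm1 rmorph1. Qed.

Lemma padic_abs_pnat : abs (p%:R : padic p_pr) = p%:R^-1.
Proof.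
rewrite [p%:R](_ : _ = (p%:Z)%:~R) // padic_abs_int pnorm_int; last first.
  by rewrite -lt0n prime_gt0.
by rewrite logn_prime // eqxx expr1 fmorphV /= ratr_nat.
Qed.

Lemma padic_absX x m : abs (x ^+ m) = abs x ^+ m.
Proof.
elim: m => [|m IH]; first by rewrite !expr0 padic_abs1.
by rewrite !exprS padic_absM IH.
Qed.

Lemma padic_absN x : abs (- x) = abs x.
Proof.
rewrite -mulN1r padic_absM (_ : -1 = (-1)%:~R) // padic_abs_int.
by rewrite mulrNz pnormN pnorm1 rmorph1 mul1r.
Qed.

Lemma padic_absD_le x y M : abs x <= M -> abs y <= M -> abs (x + y) <= M.
Proof.
by move=> xM yM; apply: le_trans (padic_absD _ _ _) _; rewrite ge_max xM.
Qed.

Lemma padic_absB_le x y M : abs x <= M -> abs y <= M -> abs (x - y) <= M.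
Proof. by move=> xM yM; apply: padic_absD_le; rewrite // padic_absN. Qed.

Lemma padic_abs_sum_le (I : finType) (F : I -> padic p_pr) M :
  0 <= M -> (forall i, abs (F i) <= M) -> abs (\sum_i F i) <= M.
Proof.
move=> M0 FM; elim/big_ind: _ => //; first by rewrite padic_abs0.
by move=> x y; exact: padic_absD_le.
Qed.

Lemma padic_abs_subX_le x y M m : abs x <= 1 -> abs y <= 1 ->
  abs (x - y) <= M -> abs (x ^+ m - y ^+ m) <= M.
Proof.
move=> x1 y1 xyM; have M0 : 0 <= M by apply: le_trans xyM; exact: padic_abs_ge0.
rewrite subrXX padic_absM -[M]mulr1; apply: ler_pM => //; rewrite ?padic_abs_ge0 //.
apply: padic_abs_sum_le => // i.
by rewrite padic_absM !padic_absX mulr_ile1 // ?exprn_ge0 ?padic_abs_ge0 //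
  exprn_ile1 ?padic_abs_ge0.
Qed.

Lemma cauchy_intE z i : (z%:~R : cauchy_seq p_pr) i = z%:~R.
Proof.
have nat_case (m : nat) : (m%:R : cauchy_seq p_pr) i = m%:R.
  by elim: m => // m IH; rewrite !mulrS -IH.
case: z => m; first exact: nat_case.
by rewrite NegzE !mulrNz; exact: (congr1 -%R (nat_case m.+1)).
Qed.

(** The denominator of q is prime to p, hence invertible modulo p^N. *)
Lemma rat_int_approx (q : rat) N : pnorm p q <= 1 ->
  exists r : int, pnorm p (q - r%:~R) <= p%:R ^- N.
Proof.
move=> q1; have p1 : (1 : rat) < p%:R by rewrite ltr1n prime_gt1.
have cop : coprime p `|denq q|%N.
  rewrite prime_coprime //; apply/negP => pd.
  have q0 : q != 0.
    by apply: contraTneq pd => ->; rewrite dvdn1 neq_ltn prime_gt1 ?orbT.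
  have pn : logn p `|numq q|%N = 0%N.
    apply: logn_coprime; rewrite coprime_sym.
    apply: coprime_dvdr pd _; exact: coprime_num_den.
  have ld : (0 < logn p `|denq q|%N)%N.
    by rewrite logn_gt0 mem_primes p_pr absz_gt0 denq_neq0.
  move: q1; rewrite /pnorm (negPf q0) /pval pn sub0r opprK -exprnP.
  by apply/negP; rewrite -ltNge exprn_egt1 // -lt0n.
have copN : coprimez (denq q) (p ^ N)%N.
  by rewrite coprimezE coprime_sym coprimeXl.
have [[s t] /= st] := coprimezP _ _ copN.
exists (numq q * s).
have d0 : (denq q)%:~R != 0 :> rat by rewrite intr_eq0 denq_neq0.
have -> : q - (numq q * s)%:~R = q * (t * (p ^ N)%N)%:~R.
  have {}st : s%:~R * (denq q)%:~R + t%:~R * (p ^ N)%N%:~R = 1 :> rat.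
    by rewrite -!intrM -intrD st.
  rewrite !intrM numqE.
  transitivity (q * (s%:~R * (denq q)%:~R + t%:~R * (p ^ N)%N%:~R) -
    q * (denq q)%:~R * s%:~R); first by rewrite st mulr1.
  by ring.
rewrite pnormM // -[leRHS]mul1r ler_pM ?pnorm_ge0 //.
by rewrite pnorm_int_le dvdz_mull.
Qed.

(** Integers are dense in the p-adic integers: a representing Cauchy sequence of
    rationals is eventually within p^-N of one of its terms, whose norm is at
    most 1 because norms are eventually constant away from 0. *)
Lemma padic_int_approx x N : abs x <= 1 ->
  exists r : int, abs (x - r%:~R) <= p%:R ^- N.
Proof.
move=> x1; set u := repr x.
have p0 : 0 < p%:R :> rat by rewrite ltr0n prime_gt0.
have e0 : 0 < (p%:R ^- N : rat) by rewrite invr_gt0 exprn_gt0.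
have e1 : (p%:R ^- N : rat) <= 1.
  by rewrite invf_le1 ?exprn_gt0 // exprn_ege1 // ler1n prime_gt0.
have /asboolP/(_ _ e0)[M hM] := cauchy_valP u.
have uM1 : pnorm p (u M) <= 1.
  rewrite leNgt; apply/negP => uM.
  suff ux : abs x = ratr (pnorm p (u M)).
    by move: x1; rewrite ux -(rmorph1 (ratr : rat -> R)) ler_rat leNgt uM.
  rewrite -[x]reprK; apply: padic_abs_lim.
  apply: cvg_near_cst.
  exists M => // i /= Mi; congr ratr; apply: pnorm_isosceles => //.
  by apply: lt_le_trans (hM _ _ Mi (leqnn M)) _; apply/ltW/(le_lt_trans e1).
have [r hr] := rat_int_approx N uM1.
exists r; rewrite -[x]reprK -(rmorph_int (\pi_(padic p_pr)%qT)) -rmorphB /=.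
set v := u - r%:~R.
have vl := @padic_abs_pi p p_pr R v.
rewrite -(cvg_lim _ vl) //; apply: limr_le; first by apply/cvg_ex; exists (abs (\pi_(padic p_pr)%qT v)).
exists M => // i /= Mi.
rewrite (_ : pnorm p _ = pnorm p (u i - r%:~R)); last by rewrite -(cauchy_intE r i).
have -> : p%:R ^- N = ratr (p%:R ^- N) :> R by rewrite fmorphV rmorphXn /= ratr_nat.
rewrite ler_rat -[u i](subrK (u M)) -addrA.
apply: le_trans (pnormD p_pr _ _) _; rewrite ge_max hr andbT.
by apply/ltW/hM.
Qed.

Lemma padic_pX_eq0 M : ((p ^ M)%:R : padic p_pr) != 0.
Proof.
rewrite natrX expf_neq0 // -(padic_abs_eq0 R) padic_abs_pnat.
by rewrite invr_eq0 pnatr_eq0 -lt0n prime_gt0.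
Qed.

Lemma padic_abs_pX M : abs ((p ^ M)%:R : padic p_pr) = (p ^ M)%:R^-1.
Proof. by rewrite natrX padic_absX padic_abs_pnat exprVn natrX. Qed.

Lemma padic_nat_mul_le (d : nat) (y : padic p_pr) M : abs y <= M -> abs (d%:R * y) <= M.
Proof.
apply: le_trans; rewrite padic_absM ler_piMl ?padic_abs_ge0 //.
exact: (padic_abs_int_le1 d).
Qed.

Lemma padic_natX (d m : nat) : ((d ^ m)%N%:Z)%:~R = d%:R ^+ m :> padic p_pr.
Proof. exact: natrX. Qed.

Lemma expn_unbounded (B : R) : exists M, B < (p ^ M)%:R.
Proof.
exists (Num.truncn B).+1; apply: lt_le_trans (truncnS_gt B) _.
by rewrite ler_nat ltnW // ltn_expl // prime_gt1.
Qed.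

Lemma exists_integral_multiple xi : exists M, abs ((p ^ M)%:R * xi) <= 1.
Proof.
have [M xM] := expn_unbounded (abs xi); exists M.
rewrite padic_absM padic_abs_pX mulrC.
by rewrite ler_pdivrMr ?mul1r ?(ltW xM) // (le_lt_trans _ xM) ?padic_abs_ge0.
Qed.

Lemma transcendental_irrational xi : ~ algebraicOver (ratr : rat -> padic p_pr) xi ->
  forall u v : int, u%:~R * xi = v%:~R -> u = 0.
Proof.
move=> tr u v uv; apply/eqP/negPn/negP => u0; apply: tr.
exists (Poly [:: - v%:~R; u%:~R : rat]).
  by rewrite -size_poly_gt0 (PolyK (c := 0)) //= intr_eq0.
rewrite /root /map_poly horner_poly (PolyK (c := 0)) ?intr_eq0 //=.
rewrite !big_ord_recl big_ord0 /= expr0 expr1 -mulrNz !ratr_int.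
by rewrite addr0 uv mulr1 mulrNz addNr.
Qed.

End PadicApproximation.

(** * Admissible exponents *)

Lemma ereal_le_real_below (R : realType) (u v : \bar R) :
  (forall c : R, (c%:E < u)%E -> (c%:E <= v)%E) -> (u <= v)%E.
Proof.
move=> h; rewrite leNgt; apply/negP => vu.
suff [c vc cu] : exists2 c : R, (v < c%:E)%E & (c%:E < u)%E.
  by have := h c cu; rewrite leNgt vc.
case: u v vu {h} => [r| |] [s| |] //=; rewrite ?lte_fin => vu.
- by exists ((s + r) / 2); rewrite lte_fin; lra.
- by exists (r - 1); rewrite ?ltNyr ?lte_fin //; lra.
- by exists (s + 1); rewrite ?ltry ?lte_fin //; lra.
- by exists 0; rewrite ?ltNyr ?ltry.
Qed.

Lemma powR_eventually_ge (R : realType) (e B : R) : 0 < e ->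
  exists A : R, forall X, A < X -> B <= X `^ e.
Proof.
move=> e0; exists (Num.max 0 (Num.max 1 B `^ e^-1)) => X.
rewrite gt_max => /andP[X0 BX].
have B1 : 0 <= Num.max 1 B by rewrite le_max ler01.
apply: (@le_trans _ _ (Num.max 1 B)); first by rewrite le_max lexx orbT.
rewrite -[leLHS]powRr1 // -[X in _ `^ X](mulVf (lt0r_neq0 e0)) powRrM.
by apply: ge0_ler_powR; rewrite ?nnegrE ?powR_ge0 ?ltW.
Qed.

(** Rescaling the height X by a constant factor costs an arbitrarily small part
    of the exponent. *)
Lemma powR_absorb (R : realType) (C s t : R) : 0 < C -> s < t ->
  exists A : R, forall X, A < X -> X `^ (- t) <= (C * X) `^ (- s).
Proof.
move=> C0 st; have [A hA] := @powR_eventually_ge R (t - s) (C `^ s) ltac:(lra).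
exists (Num.max 0 A) => X; rewrite gt_max => /andP[X0 /hA CX].
rewrite (powRM _ (ltW C0) (ltW X0)) (_ : X `^ (- s) = X `^ (t - s) * X `^ (- t)); last first.
  by rewrite -powRD; [congr (_ `^ _); lra|rewrite (lt0r_neq0 X0) implybT].
rewrite mulrA ler_peMl ?powR_ge0 //.
by rewrite powRN ler_pdivlMl ?powR_gt0 // mulr1.
Qed.

(** In the application P = p^N, H is the height of the polynomial and the left
    hand side is the Y^k allowed by the pigeonhole principle, while 1/(1+l) is
    the exponent of P in the admissible height of x.  The quantity d is the
    slack between both sides in exponents of P, used to absorb the constant. *)
Lemma height_le (R : realType) (k n : nat) (w l P q H d : R) :
  0 < 1 + w -> 1 <= P -> 0 <= q -> 0 <= H -> H <= q * P `^ (1 + w)^-1 ->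
  d = k%:R / (1 + l) - k.-1%:R - (n - k).+1%:R / (1 + w) ->
  ((2 * k.+1)%:R * q) ^+ (n - k).+1 <= P `^ d ->
  ((2 * k.+1)%:R * H) ^+ (n - k).+1 * P ^+ k.-1 <= (P `^ (1 + l)^-1) ^+ k.
Proof.
move=> w1 P1 q0 H0 HP dE CP; have P0 : 0 < P by lra.
have Pn0 : P != 0 by rewrite gt_eqF.
set s := (n - k).+1 in dE CP *.
apply: (@le_trans _ _ (((2 * k.+1)%:R * (q * P `^ (1 + w)^-1)) ^+ s * P ^+ k.-1)).
  rewrite ler_pM2r ?exprn_gt0 // lerXn2r ?nnegrE ?mulr_ge0 ?powR_ge0 //.
  by rewrite ler_wpM2l.
rewrite mulrA exprMn.
apply: (@le_trans _ _ (P `^ d * (P `^ (1 + w)^-1) ^+ s * P ^+ k.-1)).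
  by rewrite !ler_pM2r ?exprn_gt0 ?powR_gt0.
rewrite -!powR_mulrn ?powR_ge0 ?(ltW P0) // -!powRrM -!powRD ?Pn0 ?implybT //.
apply: ler_powR => //; rewrite dE.
by rewrite [(1 + w)^-1 * _]mulrC [(1 + l)^-1 * _]mulrC; lra.
Qed.

Section Exponents.
Context (R : realType) (p : nat) (p_pr : prime p).
Implicit Types (xi : padic p_pr) (a x : nat -> int).
Local Notation abs := (padic_abs R).

(** The condition defining lambda_exp, for vectors indexed by nat, of which only
    the entries up to n matter, and with the maxima spelled out. *)
Definition lambda_admissible (n : nat) xi (l : R) :=
  forall A : R, exists2 X : R, A < X & exists x,
    [/\ forall m, (m <= n)%N -> `|x m|%:~R <= X,
        exists2 m, (0 < m <= n)%N & (x 0%N)%:~R * xi ^+ m != (x m)%:~R &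
        forall m, (m <= n)%N ->
          abs ((x 0%N)%:~R * xi ^+ m - (x m)%:~R) <= X `^ (- l - 1)].

Definition w_admissible (k : nat) xi (w : R) :=
  forall A : R, exists2 X : R, A < X & exists a,
    [/\ forall i, (i <= k)%N -> `|a i|%:~R <= X,
        \sum_(i < k.+1) (a i)%:~R * xi ^+ i != 0 &
        abs (\sum_(i < k.+1) (a i)%:~R * xi ^+ i) <= X `^ (- w - 1)].

Lemma bigmax_intr_le (n : nat) (x : 'I_n.+1 -> int) (X : R) :
  (\big[Num.max/0]_(m < n.+1) `|x m|)%:~R <= X <-> forall m, `|x m|%:~R <= X.
Proof.
split=> [h m|h].
  by apply: le_trans h; rewrite ler_int; apply: le_bigmax.
have X0 : 0 <= X by apply: le_trans (h ord0); rewrite ler0z.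
elim/big_ind: _ => // y z yX zX.
by rewrite maxEle; case: ifP.
Qed.

Lemma lambda_admissibleP n xi l :
  (forall A : R, exists2 X : R, A < X & exists x : 'I_n.+1 -> int,
      (\big[Num.max/0]_(m < n.+1) `|x m|)%:~R <= X /\
      0 < \big[Num.max/0]_(m < n.+1 | (0 < m)%N)
            abs ((x ord0)%:~R * xi ^+ m - (x m)%:~R) <= X `^ (- l - 1)) <->
  lambda_admissible n xi l.
Proof.
split=> h A; have [X AX [x hx]] := h A; exists X => //.
  have {hx} [/bigmax_intr_le xX /andP[x_gt0 /bigmax_leP[X0 x_le]]] := hx.
  exists (fun m => x (inord m)).
  have -> : inord 0 = ord0 :> 'I_n.+1 by apply: val_inj; rewrite /= inordK.
  split=> [m mn||m mn]; first exact: xX.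
    apply: contrapT => no; move: x_gt0; rewrite ltNge => /negP; apply.
    apply/bigmax_leP; split=> // m m0; rewrite le_eqVlt padic_abs_eq0 subr_eq0.
    apply/orP; left; apply: contrapT => /negP xm; apply: no.
    by exists (m : nat); [rewrite m0 -ltnS ltn_ord|rewrite inord_val].
  case: m mn => [|m] mn.
    have -> : inord 0 = ord0 :> 'I_n.+1 by apply: val_inj; rewrite /= inordK.
    by rewrite expr0 mulr1 subrr padic_abs0.
  by have := x_le (inord m.+1); rewrite inordK //; apply.
have {hx} [xX [m /andP[m0 mn] xm] x_le] := hx.
exists (fun i : 'I__ => x i); split.
  by apply/bigmax_intr_le => i; apply: xX; rewrite -ltnS.
apply/andP; split.
  apply: (@lt_le_trans _ _ (abs ((x 0%N)%:~R * xi ^+ m - (x m)%:~R))).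
    by rewrite lt_def padic_abs_ge0 padic_abs_eq0 subr_eq0 xm.
  by have := @le_bigmax_cond _ _ _ 0 (Ordinal (mn : (m < n.+1)%N)) (fun i => 0 < i)%N
    (fun i : 'I_n.+1 => abs ((x 0%N)%:~R * xi ^+ i - (x i)%:~R)); apply.
apply/bigmax_leP; split=> [|i _]; first by rewrite powR_ge0.
by apply: x_le; rewrite -ltnS.
Qed.

Lemma w_admissibleP k xi w :
  (forall A : R, exists2 X : R, A < X & exists x : 'I_k.+1 -> int,
      0 < abs (\sum_(m < k.+1) (x m)%:~R * xi ^+ m) <= X `^ (- w - 1) /\
      (\big[Num.max/0]_(m < k.+1) `|x m|)%:~R <= X) <->
  w_admissible k xi w.
Proof.
split=> h A; have [X AX [x hx]] := h A; exists X => //.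
  have {hx} [/andP[P0 Ple] /bigmax_intr_le xX] := hx.
  exists (fun m => x (inord m)).
  under eq_bigr do rewrite inord_val.
  split=> [m mn||//]; first exact: xX.
  by rewrite -(padic_abs_eq0 R) gt_eqF.
have {hx} [xX P0 Ple] := hx.
exists (fun i : 'I__ => x i); split.
  by rewrite lt_def padic_abs_ge0 padic_abs_eq0 P0.
by apply/bigmax_intr_le => i; apply: xX; rewrite -ltnS.
Qed.

Lemma lambda_exp_ge n xi (l : R) :
  lambda_admissible n xi l -> (l%:E <= lambda_exp R n xi)%E.
Proof. by move=> /lambda_admissibleP h; apply: ereal_sup_ubound; exists l. Qed.

Lemma w_exp_ge k xi (w : R) : w_admissible k xi w -> (w%:E <= w_exp R k xi)%E.
Proof. by move=> /w_admissibleP h; apply: ereal_sup_ubound; exists w. Qed.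

Lemma w_exp_gt k xi (v : \bar R) : (v < w_exp R k xi)%E ->
  exists2 w : R, w_admissible k xi w & (v < w%:E)%E.
Proof.
by move=> /ereal_sup_gt[_ [w /w_admissibleP wA <-]] vw; exists w.
Qed.

Lemma lambda_exp_gt n xi (v : \bar R) : (v < lambda_exp R n xi)%E ->
  exists2 l : R, lambda_admissible n xi l & (v < l%:E)%E.
Proof.
by move=> /ereal_sup_gt[_ [l /lambda_admissibleP lA <-]] vl; exists l.
Qed.

(** Witnessed by the constant polynomials p^M, at height p^M. *)
Lemma w_admissible0 k xi : w_admissible k xi (0 : R).
Proof.
move=> B; have [M BM] := expn_unbounded p_pr B; exists (p ^ M)%:R => //.
exists (fun i => if i == 0%N then (p ^ M)%N%:Z else 0).
have -> : \sum_(i < k.+1) (if i == 0%N :> nat then (p ^ M)%N%:Z else 0)%:~R * xi ^+ i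
    = (p ^ M)%:R :> padic p_pr.
  by rewrite big_ord_recl /= mulr1 big1 ?addr0 // => i _; rewrite mul0r.
split; last 1 first.
- by rewrite oppr0 sub0r powR_inv1 ?ler0n // padic_abs_pX.
- by move=> i _; case: eqP => // _; rewrite normr0 ler0n.
- exact: padic_pX_eq0.
Qed.

(** Witnessed by the vectors (p^M, 0, ..., 0), at height p^M. *)
Lemma lambda_admissible0 n xi : (0 < n)%N -> xi != 0 -> abs xi <= 1 ->
  lambda_admissible n xi (0 : R).
Proof.
move=> n0 xi0 xi1 B; have [M BM] := expn_unbounded p_pr B; exists (p ^ M)%:R => //.
exists (fun i => if i == 0%N then (p ^ M)%N%:Z else 0); split.
- by move=> i _; case: eqP => // _; rewrite normr0 ler0n.
- by exists 1%N; rewrite ?n0 //= mulf_neq0 // padic_pX_eq0.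
- move=> [|m] _ /=.
    by rewrite expr0 mulr1 subrr padic_abs0 powR_ge0.
  rewrite subr0 oppr0 sub0r powR_inv1 ?ler0n // padic_absM padic_abs_pX.
  by rewrite ler_piMr ?invr_ge0 ?ler0n // padic_absX exprn_ile1 ?padic_abs_ge0.
Qed.

(** The polynomial d^k P(X/d) has integer coefficients and its value at d xi is
    d^k P(xi), which is p-adically no larger than P(xi). *)
Lemma w_admissible_scale k d xi (w v : R) : (d%:R : padic p_pr) != 0 -> v < w ->
  w_admissible k xi w -> w_admissible k (d%:R * xi) v.
Proof.
move=> d0 vw adm B; have d_gt0 : (0 < d)%N by rewrite lt0n; apply: contraNneq d0 => ->.
have dk0 : 0 < (d ^ k)%:R :> R by rewrite ltr0n expn_gt0 d_gt0.
have [A1 hA1] := @powR_absorb R (d ^ k)%:R (v + 1) (w + 1) dk0 ltac:(lra).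
have [X] := adm (Num.max (Num.max 0 B) A1); rewrite !gt_max.
move=> /andP[/andP[X0 BX] A1X] [a [aX Pn0 Ple]].
exists ((d ^ k)%:R * X).
  by apply: lt_le_trans BX _; rewrite ler_peMl ?(ltW X0) // ler1n expn_gt0 d_gt0.
have PE : \sum_(i < k.+1) (a i * (d ^ (k - i))%N%:Z)%:~R * (d%:R * xi) ^+ i =
    (d ^ k)%:R * \sum_(i < k.+1) (a i)%:~R * xi ^+ i.
  rewrite mulr_sumr; apply: eq_bigr => i _; have ik : (i <= k)%N by rewrite -ltnS.
  have -> : (d ^ k)%:R = d%:R ^+ (k - i) * d%:R ^+ i :> padic p_pr.
    by rewrite natrX -exprD subnK.
  by rewrite intrM padic_natX exprMn; ring.
exists (fun i => a i * (d ^ (k - i))%N%:Z); rewrite PE; split.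
- move=> i ik; rewrite normrM intrM mulrC; apply: ler_pM; rewrite ?ler0z ?aX //.
  rewrite -[_%:~R]/((d ^ (k - i))%:R) ler_nat leq_pexp2l // leq_subr //.
- by rewrite mulf_neq0 // natrX expf_neq0.
- apply: padic_nat_mul_le; apply: le_trans Ple _.
  by have := hA1 _ A1X; rewrite !opprD.
Qed.

(** Multiplying x_m by d^(n-m) turns an approximation of d xi into one of xi,
    with differences multiplied by d^(n-m). *)
Lemma lambda_admissible_scale n d xi (l v : R) : (d%:R : padic p_pr) != 0 -> v < l ->
  lambda_admissible n (d%:R * xi) l -> lambda_admissible n xi v.
Proof.
move=> d0 vl adm B; have d_gt0 : (0 < d)%N by rewrite lt0n; apply: contraNneq d0 => ->.
have dn0 : 0 < (d ^ n)%:R :> R by rewrite ltr0n expn_gt0 d_gt0.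
have [A1 hA1] := @powR_absorb R (d ^ n)%:R (v + 1) (l + 1) dn0 ltac:(lra).
have [X] := adm (Num.max (Num.max 0 B) A1); rewrite !gt_max.
move=> /andP[/andP[X0 BX] A1X] [x [xX [m1 m1n xm1] xle]].
exists ((d ^ n)%:R * X).
  by apply: lt_le_trans BX _; rewrite ler_peMl ?(ltW X0) // ler1n expn_gt0 d_gt0.
have xE m : (m <= n)%N ->
    (x 0%N * (d ^ (n - 0))%N%:Z)%:~R * xi ^+ m - (x m * (d ^ (n - m))%N%:Z)%:~R =
    (d ^ (n - m))%:R * ((x 0%N)%:~R * (d%:R * xi) ^+ m - (x m)%:~R) :> padic p_pr.
  move=> mn; rewrite !intrM !padic_natX subn0 natrX exprMn.
  have -> : d%:R ^+ n = d%:R ^+ (n - m) * d%:R ^+ m :> padic p_pr.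
    by rewrite -exprD subnK.
  by ring.
exists (fun m => x m * (d ^ (n - m))%N%:Z); split.
- move=> i ik; rewrite normrM intrM mulrC; apply: ler_pM; rewrite ?ler0z ?xX //.
  rewrite -[_%:~R]/((d ^ (n - i))%:R) ler_nat leq_pexp2l // leq_subr //.
- exists m1 => //; have /andP[_ m1n'] := m1n.
  rewrite -subr_eq0 xE // mulf_neq0 ?natrX ?expf_neq0 //.
  by rewrite subr_eq0.
- move=> m mn; rewrite xE //; apply: padic_nat_mul_le; apply: le_trans (xle m mn) _.
  by have := hA1 _ A1X; rewrite !opprD.
Qed.

Lemma w_exp_scale k d xi : (d%:R : padic p_pr) != 0 ->
  (w_exp R k xi <= w_exp R k (d%:R * xi)%R)%E.
Proof.
move=> d0; apply: ereal_le_real_below => c /w_exp_gt[w wA]; rewrite lte_fin => cw.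
by apply/w_exp_ge/(w_admissible_scale d0 cw).
Qed.

Lemma lambda_exp_scale n d xi : (d%:R : padic p_pr) != 0 ->
  (lambda_exp R n (d%:R * xi)%R <= lambda_exp R n xi)%E.
Proof.
move=> d0; apply: ereal_le_real_below => c /lambda_exp_gt[l lA]; rewrite lte_fin => cl.
by apply/lambda_exp_ge/(lambda_admissible_scale d0 cl).
Qed.

Lemma w_exp_ge0 k xi : (0 <= w_exp R k xi)%E.
Proof. exact/w_exp_ge/w_admissible0. Qed.

Lemma lambda_exp_ge0 n xi : (0 < n)%N -> xi != 0 -> (0 <= lambda_exp R n xi)%E.
Proof.
move=> n0 xi0; have [M xi1] := exists_integral_multiple R xi.
have d0 := padic_pX_eq0 R p_pr M.
apply: le_trans (lambda_exp_scale _ _ d0).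
by apply/lambda_exp_ge/lambda_admissible0; rewrite // mulf_neq0.
Qed.

(** * Transference for an integral p-adic number *)

(** Replacing xi by an integer r with |xi - r|_p <= p^-N changes neither the
    hypothesis nor the conclusion, by the ultrametric inequality; what remains
    is integer_transference, with the largest Y that its count allows. *)
Lemma simultaneous_of_primitive (k n N H : nat) xi (b : nat -> int) :
  (0 < k <= n)%N -> abs xi <= 1 -> (0 < N)%N ->
  (exists2 i, (i <= k)%N & ~~ (p %| b i)%Z) ->
  (forall i, (i <= k)%N -> `|b i| <= H) ->
  abs (\sum_(i < k.+1) (b i)%:~R * xi ^+ i) <= p%:R ^- N ->
  exists Y x, [/\ (Y ^ k <= (2 * k.+1 * H) ^ (n - k).+1 * (p ^ N) ^ k.-1)%N,
    exists2 m, (m <= n)%N & x m != 0, forall m, `|x m| <= Y &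
    forall m, (m <= n)%N -> abs ((x 0%N)%:~R * xi ^+ m - (x m)%:~R) <= p%:R ^- N].
Proof.
move=> /andP[k0 kn] xi1 N0 prim bH Pxi.
have [r xir] := padic_int_approx N xi1.
have H0 : (0 < H)%N.
  have [i ik bi] := prim; have := bH i ik; rewrite -ltz_nat; apply: lt_le_trans.
  by rewrite normr_gt0; apply: contraNneq bi => ->; rewrite dvdz0.
have xirX m : abs (xi ^+ m - r%:~R ^+ m) <= p%:R ^- N.
  by apply: padic_abs_subX_le => //; exact: padic_abs_int_le1.
have intM (z : int) (y : padic p_pr) (M : R) : abs y <= M -> abs (z%:~R * y) <= M.
  apply: le_trans; rewrite padic_absM ler_piMl ?padic_abs_ge0 //.
  exact: padic_abs_int_le1.
have Pr : ((p ^ N)%N %| \sum_(i < k.+1) b i * r ^+ i)%Z.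
  rewrite -(padic_abs_int_le R p_pr) rmorph_sum /=.
  rewrite (_ : \sum_i _ = \sum_(i < k.+1) (b i)%:~R * xi ^+ i -
    \sum_(i < k.+1) (b i)%:~R * (xi ^+ i - r%:~R ^+ i)); last first.
    rewrite -sumrB; apply: eq_bigr => i _.
    by rewrite intrM rmorphXn /= -mulrBr opprB addrC subrK.
  apply: padic_absB_le => //; apply: padic_abs_sum_le => [|i]; last exact: intM.
  by rewrite invr_ge0 exprn_ge0.
have [Y /andP[YQ QY]] := natural_root ((2 * k.+1 * H) ^ (n - k).+1 * (p ^ N) ^ k.-1) k0.
have kn' : (0 < k <= n)%N by rewrite k0.
have [x [xn0 xY xP]] := integer_transference p_pr kn' N0 H0 prim bH Pr QY.
exists Y, x; split=> // m mn.
rewrite (_ : _ - _ = (x 0%N)%:~R * (xi ^+ m - r%:~R ^+ m) +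
  (x 0%N * r ^+ m - x m)%:~R); last first.
  by rewrite intrB intrM rmorphXn /=; ring.
apply: padic_absD_le; first exact: intM.
by rewrite padic_abs_int_le xP.
Qed.

(** With p^c the p-part of the content of a, b = a / p^c has height at most
    X / p^c, and T = X^(w+1) / p^c bounds the inverse of its value at xi.  As
    p^c <= X and w >= 0, both X^w and the (w+1)-st power of the height of b are
    at most T: the exponent w survives, and T tends to infinity with X when
    w > 0. *)
Lemma primitive_approximation (k : nat) xi (w X : R) a : 0 <= w -> 1 <= X ->
  (forall i, (i <= k)%N -> `|a i|%:~R <= X) ->
  \sum_(i < k.+1) (a i)%:~R * xi ^+ i != 0 ->
  abs (\sum_(i < k.+1) (a i)%:~R * xi ^+ i) <= X `^ (- w - 1) ->
  exists (T : R) (H : nat) (b : nat -> int),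
    [/\ X `^ w <= T, H%:R `^ (1 + w) <= T,
     exists2 i, (i <= k)%N & ~~ (p %| b i)%Z,
     forall i, (i <= k)%N -> `|b i| <= H &
     abs (\sum_(i < k.+1) (b i)%:~R * xi ^+ i) <= T^-1].
Proof.
move=> w0 X1 aX Pn0 Ple; have X0 : 0 < X by lra.
have an0 : exists2 i, (i <= k)%N & a i != 0.
  apply: contrapT => no; move/eqP: Pn0; apply; apply: big1 => i _.
  have [->|ai] := eqVneq (a i) 0; first by rewrite mul0r.
  by case: no; exists (i : nat); rewrite // -ltnS.
have [c [b [ab bprim]]] := content_factor p_pr an0.
set C : R := (p ^ c)%:R.
have C1 : 1 <= C by rewrite ler1n expn_gt0 prime_gt0.
have C0 : 0 < C by lra.
have bX i : (i <= k)%N -> `|b i|%:~R <= X / C :> R.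
  move=> ik; have := aX i ik; rewrite ab // normrM intrM.
  by rewrite ler_pdivlMr // mulrC.
pose H := \max_(i < k.+1) `|b i|%N.
have HX : H%:R <= X / C.
  rewrite /H; elim/big_ind: _ => [|u v uX vX|i _].
  - by rewrite divr_ge0 ?(ltW X0) ?(ltW C0).
  - by rewrite /maxn; case: ifP.
  - by have := bX i; rewrite -ltnS ltn_ord => /(_ erefl); rewrite -abszE.
have bH i : (i <= k)%N -> `|b i| <= H.
  move=> ik; rewrite -abszE lez_nat.
  exact: (@leq_bigmax _ (fun i : 'I_k.+1 => `|b i|%N) (Ordinal (ik : (i < k.+1)%N))).
have XC1 : 1 <= X / C.
  have [i ik bi] := bprim; apply: le_trans (bX i ik).
  rewrite ler1z -gtz0_ge1 normr_gt0.
  by apply: contraNneq bi => ->; rewrite dvdz0.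
have XE : X `^ (1 + w) = X `^ w * X.
  by rewrite addrC powRD ?(gt_eqF X0) ?implybT // powRr1 // ltW.
exists (X `^ (1 + w) / C), H, b; split=> //.
- by rewrite XE -mulrA ler_peMr ?powR_ge0.
- apply: (@le_trans _ _ ((X / C) `^ (1 + w))).
    by apply: ge0_ler_powR; rewrite ?nnegrE ?ler0n //; [lra|exact: le_trans XC1].
  rewrite powRM ?invr_ge0 ?(ltW X0) ?(ltW C0) // ler_pM2l ?powR_gt0 //.
  rewrite -powR_inv1 ?(ltW C0) // powRAC !powR_inv1 ?powR_ge0 ?(ltW C0) //.
  by rewrite lef_pV2 ?posrE ?powR_gt0 // le1r_powR //; lra.
- have PE : \sum_(i < k.+1) (a i)%:~R * xi ^+ i =
      (p ^ c)%:R * \sum_(i < k.+1) (b i)%:~R * xi ^+ i.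
    rewrite mulr_sumr; apply: eq_bigr => i _.
    by rewrite ab ?intrM ?mulrA // -ltnS.
  move: Ple; rewrite PE padic_absM padic_abs_pX -/C mulrC ler_pdivrMr //.
  by rewrite invf_div mulrC -powRN opprD addrC.
Qed.

(** The linear inequality says that l is below (w - n + k) / ((k - 1) w + n), in
    a form that avoids the division.  It is equivalent to d > 0 below. *)
Lemma transference (k n : nat) xi (w l : R) : (0 < k <= n)%N -> abs xi <= 1 ->
  (forall u v : int, u%:~R * xi = v%:~R -> u = 0) ->
  0 < w -> 0 <= l -> l * ((k%:R - 1) * w + n%:R) < w - n%:R + k%:R ->
  w_admissible k xi w -> lambda_admissible n xi l.
Proof.
move=> /andP[k0 kn] xi1 irr w0 l0 lw adm B.
pose d := k%:R / (1 + l) - k.-1%:R - (n - k).+1%:R / (1 + w).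
have d0 : 0 < d.
  have w1 : 0 < 1 + w by lra.
  have l1 : 0 < 1 + l by lra.
  have kE : k%:R = k.-1%:R + 1 :> R by rewrite -{1}(prednK k0) -natr1.
  have nE : (n - k).+1%:R = n%:R - k.-1%:R :> R.
    by rewrite -natr1 natrB // kE; lra.
  rewrite /d -(pmulr_lgt0 _ w1) -(pmulr_lgt0 _ l1).
  rewrite (_ : _ * _ = k%:R * (1 + w) - (1 + l) * (k.-1%:R * (1 + w) + (n - k).+1%:R)).
    by rewrite nE; move: lw; rewrite kE; nra.
  by field; rewrite !gt_eqF.
have p0 : 0 < p%:R :> R by rewrite ltr0n prime_gt0.
have p1 : 1 <= p%:R :> R by rewrite ler1n prime_gt0.
have [A1 hA1] := powR_eventually_ge (((2 * k.+1)%:R * p%:R) ^+ (n - k).+1) d0.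
have l1 : 0 < (1 + l)^-1 by rewrite invr_gt0; lra.
have [A2 hA2] := powR_eventually_ge (B + 1) l1.
(* M is a size of p^N beyond which the constants are absorbed; as p^N > T / p
   and T >= X^w, taking X large reaches it. *)
set M := Num.max 1 (Num.max A1 A2).
have [A3 hA3] := powR_eventually_ge (p%:R * (M + 1)) w0.
have [X] := adm (Num.max 1 A3); rewrite gt_max => /andP[X1 /hA3 XM].
move=> [a [aX Pn0 Ple]].
have [T [H [b [XT HT bprim bH bT]]]] := primitive_approximation (ltW w0) (ltW X1) aX Pn0 Ple.
have MT : p%:R * (M + 1) <= T by apply: le_trans XT.
have M1 : 1 <= M by rewrite /M le_max lexx.
have T1 : 1 <= T by apply: le_trans MT; nra.
have [N /andP[NT TN]] : exists N, ((p ^ N)%:R <= T) && (T < (p ^ N.+1)%:R).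
  exists (trunc_log p (Num.truncn T)).
  have t0 : (0 < Num.truncn T)%N by rewrite truncn_gt0.
  have /andP[h1 h2] := trunc_log_bounds (prime_gt1 p_pr) t0.
  have /andP[h3 h4] := truncn_itv (le_trans ler01 T1).
  apply/andP; split; first by apply: le_trans h3; rewrite ler_nat.
  by apply: lt_le_trans h4 _; rewrite ler_nat.
set P : R := (p ^ N)%:R in NT.
have MP : M < P.
  have : p%:R * (M + 1) < p%:R * P by rewrite -natrM -expnS; exact: le_lt_trans TN.
  by rewrite ltr_pM2l //; lra.
have /andP[P1 /andP[A1P A2P]] : [&& 1 < P, A1 < P & A2 < P].
  by rewrite !(le_lt_trans _ MP) // /M !le_max lexx ?orbT.
have N0 : (0 < N)%N.
  by rewrite lt0n; apply: contraTneq P1 => N0; rewrite /P N0 expn0 ltxx.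
have P0 : 0 < P by lra.
have PpN : p%:R ^- N = P^-1 by rewrite /P natrX.
have [|Y [x [YQ xn0 xY xle]]] := simultaneous_of_primitive (N := N) (introT andP (conj k0 kn)) xi1 N0 bprim bH.
  by apply: le_trans bT _; rewrite PpN lef_pV2 ?posrE //; lra.
exists (P `^ (1 + l)^-1); first by have := hA2 _ A2P; lra.
have HP : H%:R <= p%:R * P `^ (1 + w)^-1.
  have w1 : 0 < 1 + w by lra.
  have iw1 : 0 < (1 + w)^-1 by rewrite invr_gt0.
  rewrite (_ : H%:R = (H%:R `^ (1 + w)) `^ (1 + w)^-1); last first.
    by rewrite -powRrM mulfV ?(lt0r_neq0 w1) // powRr1.
  apply: (@le_trans _ _ ((p%:R * P) `^ (1 + w)^-1)).
    apply: ge0_ler_powR; rewrite ?nnegrE ?powR_ge0 ?mulr_ge0 ?(ltW p0) ?(ltW P0) ?(ltW iw1) //.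
    by apply: le_trans HT _; rewrite -natrM -expnS ltW.
  rewrite powRM ?(ltW p0) ?(ltW P0) // ler_pM2r ?powR_gt0 // ler1_powR //.
  by rewrite invf_le1; lra.
have YP : Y%:R <= P `^ (1 + l)^-1.
  rewrite -(@ler_pXn2r _ k) ?nnegrE ?powR_ge0 //.
  have w1 : 0 < 1 + w by lra.
  apply: le_trans (height_le w1 (ltW P1) (ltW p0) (ler0n _ _) HP erefl (hA1 _ A1P)).
  by rewrite -natrX -natrM -natrX -natrX -natrM ler_nat.
exists x; split.
- move=> m _; apply: le_trans YP.
  by rewrite -[Y%:R]/((Y%:Z)%:~R) ler_int.
(* If all differences vanished then x would be zero, xi being irrational. *)
- apply: contrapT => no.
  have xm0 m : (0 < m <= n)%N -> (x 0%N)%:~R * xi ^+ m = (x m)%:~R.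
    by move=> mn; apply/eqP/negPn/negP => ne; apply: no; exists m.
  have x00 : x 0%N = 0.
    by apply: (irr _ (x 1%N)); rewrite -(xm0 1%N) ?expr1 // (leq_trans k0 kn).
  have [[|m] mn xm] := xn0; first by rewrite x00 eqxx in xm.
  move/esym/eqP: (xm0 m.+1 mn); rewrite x00 mul0r -(padic_abs_eq0 R) padic_abs_int.
  by rewrite fmorph_eq0 pnorm_eq0 // intr_eq0; apply/negP.
- move=> m mn; rewrite -powRrM (_ : (1 + l)^-1 * _ = -1); last by field; lra.
  by rewrite powR_inv1 ?(ltW P0) // -PpN xle.
Qed.

(** * Transference between the exponents *)

(** The value compared with w_exp is the w at which the bound equals l, so the
    hypotheses say that l is less than the bound at w_k(xi), also when the
    latter is infinite.  Passing to p^M xi brings xi into the unit ball. *)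
Lemma lambda_exp_ge_of_w_exp (k n : nat) xi (l : R) : (0 < k <= n)%N ->
  (forall u v : int, u%:~R * xi = v%:~R -> u = 0) -> 0 <= l ->
  0 < 1 - l * (k%:R - 1) ->
  (((n%:R - k%:R + l * n%:R) / (1 - l * (k%:R - 1)))%:E < w_exp R k xi)%E ->
  (l%:E <= lambda_exp R n xi)%E.
Proof.
move=> kn irr l0 c0 lw; have [M xi1] := exists_integral_multiple R xi.
have d0 := padic_pX_eq0 R p_pr M.
apply: le_trans (lambda_exp_scale _ _ d0).
have [w wA] := w_exp_gt (lt_le_trans lw (w_exp_scale k xi d0)).
rewrite lte_fin ltr_pdivrMr // => wlt.
have kn' : k%:R <= n%:R :> R by rewrite ler_nat; case/andP: kn.
have w0 : 0 < w.
  have : 0 <= n%:R - k%:R + l * n%:R by rewrite addr_ge0 ?subr_ge0 ?mulr_ge0.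
  by move=> h; have := le_lt_trans h wlt; rewrite pmulr_lgt0.
apply: lambda_exp_ge; apply: transference kn xi1 _ w0 l0 _ wA; last by nra.
move=> u v; rewrite mulrA => uv.
have /eqP := irr (u * (p ^ M)%N%:Z) v ltac:(by rewrite intrM).
by rewrite mulf_eq0 => /orP[/eqP //|]; rewrite gt_eqF // ltz_nat expn_gt0 prime_gt0.
Qed.

End Exponents.

Theorem theorem2p6 (R : realType) (p : nat) (p_pr : prime p) (k n : nat)
    (k_gt0 : (1 <= k)%N) (k_le_n : (k <= n)%N) (xi : padic p_pr)
    (xi_transc : ~ algebraicOver (ratr : rat -> padic p_pr) xi) :
  (transference_bound k n (w_exp R k xi) <= lambda_exp R n xi)%E.
Proof.
have irr := transcendental_irrational xi_transc.
have xi0 : xi != 0.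
  apply/eqP => xi0; have /eqP := irr 1 0 ltac:(by rewrite xi0 mulr0).
  by rewrite oner_eq0.
have kn : (0 < k <= n)%N by rewrite k_gt0.
have L0 := lambda_exp_ge0 R (leq_trans k_gt0 k_le_n) xi0.
have W0 := w_exp_ge0 R k xi.
have k1 : 1 <= k%:R :> R by rewrite ler1n.
have knR : k%:R <= n%:R :> R by rewrite ler_nat.
apply: ereal_le_real_below => c.
have [c0|c0] := ltP c 0.
  by move=> _; apply: le_trans L0; rewrite lee_fin ltW.
move=> cb.
have [pos lw] : 0 < 1 - c * (k%:R - 1) /\
    (((n%:R - k%:R + c * n%:R) / (1 - c * (k%:R - 1)))%:E < w_exp R k xi)%E.
  case: (w_exp R k xi) W0 cb => [r| |] //=; last 1 first.
    case: ifP => [k2|k2]; first rewrite lte_fin => _ cb.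
      have k2R : 0 < k%:R - 1 :> R by rewrite subr_gt0 ltr1n.
      by rewrite ltry; split=> //; rewrite subr_gt0 -ltr_pdivlMr // div1r.
    have -> : k = 1%N by lia.
    by move=> _ _; split; [rewrite subrr mulr0 subr0 ltr01|rewrite ltry].
  rewrite lee_fin !lte_fin => r0.
  have n0 : 0 < n%:R :> R by lra.
  have den : 0 < (k%:R - 1) * r + n%:R by rewrite ltr_wpDl // mulr_ge0 // subr_ge0.
  rewrite ltr_pdivlMr // => cr.
  have pos : 0 < 1 - c * (k%:R - 1).
    have : 0 < (1 - c * (k%:R - 1)) * r by nra.
    by apply: contraLR; rewrite -!leNgt => h; apply: mulr_le0_ge0.
  by split=> //; rewrite ltr_pdivrMr //; nra.
exact: lambda_exp_ge_of_w_exp kn irr c0 pos lw.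
Qed.
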